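(* Suppose $U\in\mathcal{CU}_\mu(\mathbb C^J)$, $\mu=(\mu_0,\dots,\mu_{J-1})$, $e=(1,\dots,1)\in\mathbb C^J$, and $\mathbf B=b(U)$. Then $$\mathfrak h(U)=-\sum_{j,k=0}^{J-1}\big(\mathcal P^T_{\mathrm{Ker}(\mathbf B-I)}e\big)_j\,\mathbf B_{jk}\,\big(\mathcal P_{\mathrm{Ker}(\mathbf B-I)}\mu\big)_k\log\mathbf B_{jk}.$$
   Context: Let $J\ge1$ and $\mu_0,\dots,\mu_{J-1}>0$ be the first $J$ terms of a sequence $(\mu_j)_{j\in\mathbb N_0}$ of positive numbers with sum $1$ (or positive numbers themselves summing to $1$). $\mathbb C^J$ carries $\langle x,y\rangle=\sum_{j=0}^{J-1}\mu_jx_j\overline{y_j}$, $\|x\|=\sqrt{\langle x,x\rangle}$, and $\mathcal{CU}_\mu(\mathbb C^J)$ is the set of linear operators $U$ on $\mathbb C^J$ with $\|Ux\|\le\|x\|$ for all $x$. Let $(U_{jk})$ be the matrix of $U$ in coordinates, $(Ux)_j=\sum_kU_{jk}x_k$, and $b(U)=\mathbf B$ the $J\times J$ matrix $\mathbf B_{jk}=\frac{\mu_j}{\mu_k}|U_{jk}|^2$. Its row and column sums are at most $1$, and $\mathbb C^J=\mathrm{Ker}(\mathbf B-I)\oplus\mathrm{Im}(\mathbf B-I)$; $\mathcal P_{\mathrm{Ker}(\mathbf B-I)}$ is the projection onto $\mathrm{Ker}(\mathbf B-I)$ along $\mathrm{Im}(\mathbf B-I)$, and $\mathcal P^T$ is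 its transpose matrix. Convention: $0\log0=0$. Entropy: for a partition $\chi=\{X_0,\dots,X_K\}$ of $\{0,\dots,J-1\}$ (pairwise disjoint sets with full union), $n\ge1$ and a map $\sigma:\{0,\dots,n\}\to\{0,\dots,K\}$ (the set of such maps is $\mathcal S_{n,K}$) put $$\mathcal I_U(\mathbf G_\sigma)=\sum_{j_0,\dots,j_n=0}^{J-1}\mathbf 1_{X_{\sigma(n)}}(j_n)\,\mathbf B_{j_nj_{n-1}}\mathbf 1_{X_{\sigma(n-1)}}(j_{n-1})\cdots\mathbf B_{j_1j_0}\mathbf 1_{X_{\sigma(0)}}(j_0)\,\mu_{j_0},$$ $\mathfrak h(U,\chi,n)=-\sum_{\sigma\in\mathcal S_{n,K}}\mathcal I_U(\mathbf G_\sigma)\log\mathcal I_U(\mathbf G_\sigma)$, $\mathfrak h(U,\chi)=\lim_{n\to\infty}\frac1n\mathfrak h(U,\chi,n)$ (when the limit exists), and $\mathfrak h(U)=\sup_\chi\mathfrak h(U,\chi)$. *)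

(* Defs.v *)
From HB Require Import structures.
From mathcomp Require Export all_boot all_order all_algebra.
From mathcomp Require Export all_classical all_reals all_analysis.
From mathcomp Require Export complex.
Export Order.TTheory GRing.Theory Num.Theory.
Export numFieldNormedType.Exports.

Set Implicit Arguments.
Unset Strict Implicit.
Unset Printing Implicit Defensive.

Local Open Scope ring_scope.
Local Open Scope complex_scope.

Section Weights.
Variables (R : realType) (J : nat).

(* Either an initial segment of a positive sequence of sum 1, or J positive
   numbers of sum 1. *)
Definition is_weight (mu : 'I_J -> R) : Prop :=
  (exists m : nat -> R,
     [/\ forall j, 0 < m j,
         (series m @ \oo --> (1 : R))%classic
       & forall j : 'I_J, mu j = m j])
  \/ ((forall j, 0 < mu j) /\ \sum_(j < J) mu j = 1).

Definition wdot (mu : 'I_J -> R) (x y : 'cV[R[i]]_J) : R[i] :=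
  \sum_(j < J) (mu j)%:C * x j 0 * (y j 0)^*.

Definition wnorm (mu : 'I_J -> R) (x : 'cV[R[i]]_J) : R[i] :=
  sqrtC (wdot mu x x).

(* U acts on column vectors by x |-> U *m x; the norms compared are nonnegative
   reals embedded in R[i]. *)
Definition weighted_contraction (mu : 'I_J -> R) (U : 'M[R[i]]_J) : Prop :=
  forall x : 'cV[R[i]]_J, wnorm mu (U *m x) <= wnorm mu x.

Definition bmatrix (mu : 'I_J -> R) (U : 'M[R[i]]_J) : 'M[R]_J :=
  \matrix_(j, k) (mu j / mu k * (Normc.normc (U j k)) ^+ 2).

Definition is_indexed_partition (K : nat) (X : 'I_K.+1 -> {set 'I_J}) : Prop :=
  (forall i k : 'I_K.+1, i != k -> [disjoint X i & X k])
  /\ \bigcup_(i < K.+1) X i = [set: 'I_J].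

Section Entropy.
Variables (mu : 'I_J -> R) (U : 'M[R[i]]_J).

(* For t : 'I_n, widen_ord _ t and lift ord0 t are the indices t and t + 1 of
   {0, ..., n}. *)
Definition cylinder_weight (K : nat) (X : 'I_K.+1 -> {set 'I_J}) (n : nat)
    (s : {ffun 'I_n.+1 -> 'I_K.+1}) : R :=
  \sum_(j : {ffun 'I_n.+1 -> 'I_J})
    (\prod_(t < n.+1) (j t \in X (s t))%:R)
    * (\prod_(t < n)
         bmatrix mu U (j (lift ord0 t)) (j (widen_ord (leqnSn n) t)))
    * mu (j ord0).

(* ln 0 = 0 in the library, hence 0 * ln 0 = 0. *)
Definition partition_entropy_n (K : nat) (X : 'I_K.+1 -> {set 'I_J})
    (n : nat) : R :=
  - \sum_(s : {ffun 'I_n.+1 -> 'I_K.+1})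
      cylinder_weight X s * ln (cylinder_weight X s).

Definition is_partition_entropy (K : nat) (X : 'I_K.+1 -> {set 'I_J})
    (h : R) : Prop :=
  ((fun n : nat => n%:R^-1 * partition_entropy_n X n) @ \oo --> h)%classic.

(* Supremum over the partitions whose entropy limit exists. *)
Definition operator_entropy : \bar R :=
  ereal_sup [set h%:E | h in
    [set h : R | exists (K : nat) (X : 'I_K.+1 -> {set 'I_J}),
       is_indexed_partition X /\ is_partition_entropy X h]]%classic.

End Entropy.
End Weights.

(* Projection onto Ker A along Im A, acting on column vectors. The library's
   subspaces are row spaces and proj_mx acts on rows, hence the transposes:
   the rows of kermx A^T span {v^T | A v = 0} and those of A^T span
   {(A w)^T}. *)
Definition ker_im_proj (F : fieldType) (n : nat) (A : 'M[F]_n) : 'M[F]_n :=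
  (proj_mx (kermx A^T) A^T)^T.

Lemma ker_im_proj_ker (F : fieldType) (n : nat) (A : 'M[F]_n) (v : 'cV[F]_n) :
  (kermx A^T :&: A^T = 0)%MS -> A *m v = 0 -> ker_im_proj A *m v = v.
Proof.
move=> dx Av; apply: trmx_inj; rewrite trmx_mul trmxK proj_mx_id//.
by apply/sub_kermxP; rewrite -trmx_mul Av trmx0.
Qed.

Lemma ker_im_proj_im (F : fieldType) (n : nat) (A : 'M[F]_n) (w : 'cV[F]_n) :
  (kermx A^T :&: A^T = 0)%MS -> ker_im_proj A *m (A *m w) = 0.
Proof.
move=> dx; apply: trmx_inj; rewrite trmx_mul trmxK proj_mx_0 ?trmx0//.
by rewrite trmx_mul submxMl.
Qed.

(* Main.v *)
(**
  B has nonnegative entries and column sums at most 1. Since -x ln x is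
  subadditive, no partition has larger entropy at time n than the partition into
  singletons, so the supremum is the entropy of the latter. There the entropy
  at time n is the sum over t < n of
    -sum_(a,b) (e^T B^(n-1-t))_a B_ab (B^t mu)_b ln B_ab,
  up to a bounded term. The row vectors e^T B^s decrease with s, hence converge,
  and the Cesaro means of B^t converge to the projection P onto Ker(B - I)
  along Im(B - I), so the limit of e^T B^s is e^T P. A convergent sequence
  convolved with a bounded Cesaro convergent one has Cesaro limit the product
  of the limits, and this gives the formula.
*)
Require Import Defs.
From mathcomp Require Import ring.

Set Implicit Arguments.
Unset Strict Implicit.
Unset Printing Implicit Defensive.
Local Open Scope ring_scope.
Local Open Scope complex_scope.
Local Open Scope classical_set_scope.

(** * Cesaro means of sequences and of convolutions *)

Section CesaroMeans.
Variable R : realType.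
Implicit Types (a b u : nat -> R).

Lemma cvg_invn : (fun n : nat => (n%:R : R)^-1) @ \oo --> (0 : R).
Proof. by rewrite -cvg_shiftS; exact: cvg_harmonic. Qed.

Lemma cvg_cesaro u (l : R) : u @ \oo --> l ->
  (fun n : nat => n%:R^-1 * \sum_(t < n) u t) @ \oo --> l.
Proof.
(* The library's [arithmetic_mean] at [n] averages [n.+1] terms, hence the shift. *)
move=> /cesaro ul; rewrite -cvg_shiftS; apply: cvg_trans ul.
apply: near_eq_cvg; apply: nearW => n.
by rewrite /arithmetic_mean /series /= big_mkord.
Qed.

Lemma cvg_sum_ord (m : nat) (f : 'I_m -> nat -> R) (l : 'I_m -> R) :
  (forall i, f i @ \oo --> l i) ->
  (fun n => \sum_(i < m) f i n) @ \oo --> \sum_(i < m) l i.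
Proof.
elim: m f l => [|m IHm] f l fl.
  rewrite big_ord0 (_ : (fun _ => _) = fun=> 0); first exact: cvg_cst.
  by apply/funext => n; rewrite big_ord0.
rewrite big_ord_recl (_ : (fun _ => _) =
    fun n => f ord0 n + \sum_(i < m) f (lift ord0 i) n); last first.
  by apply/funext => n; rewrite big_ord_recl.
by apply: cvgD; [exact: fl|apply: IHm => i; exact: fl].
Qed.

(** Replacing [a] by its limit [la] costs at most [M] times a Cesaro mean of [|a - la|], which tends
    to 0; what remains is [la] times the mean of [b]. *)
Lemma cvg_cesaro_convolution a b (la lb M : R) :
  a @ \oo --> la -> (forall t, `|b t| <= M) ->
  (fun n : nat => n%:R^-1 * \sum_(t < n) b t) @ \oo --> lb ->
  (fun n : nat => n%:R^-1 * \sum_(t < n) a (n - t.+1)%N * b t) @ \oo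
    --> la * lb.
Proof.
move=> ala bM blb.
suff d0 : (fun n : nat => n%:R^-1 * \sum_(t < n) (a (n - t.+1)%N - la) * b t)
    @ \oo --> (0 : R).
  rewrite -[X in _ --> X]add0r.
  apply: cvg_trans (cvgD d0 (cvgM (cvg_cst la) blb)).
  apply: near_eq_cvg; apply: nearW => n /=.
  rewrite addrfctE/= mulrCA -mulrDr; congr (_ * _).
  rewrite mulr_sumr -big_split/=; apply: eq_bigr => t _.
  by rewrite -mulrDl subrK.
have a0 : (fun n => `|a n - la| * M) @ \oo --> (0 : R).
  rewrite -(mul0r M); apply: cvgMr_tmp.
  by apply/norm_cvg0P/subr_cvg0.
apply: norm_cvg0; apply: (squeeze_cvgr _ (cvg_cst 0) (cvg_cesaro a0)).
apply: nearW => n; rewrite normr_ge0/= normrM ger0_norm ?invr_ge0//.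
apply: ler_wpM2l; first by rewrite invr_ge0.
apply: le_trans (ler_norm_sum _ _ _) _.
(* Reversing the order of summation turns index [t] into [n - t.+1], as on the left. *)
rewrite [leRHS](reindex_inj rev_ord_inj)/=; apply: ler_sum => t _.
by rewrite normrM ler_wpM2l.
Qed.

End CesaroMeans.

(** * Column-substochastic matrices and their powers *)

Section ColumnSubstochastic.
Variables (R : realType) (n : nat).
Implicit Types B C : 'M[R]_n.

Definition column_substochastic B : Prop :=
  (forall i k, 0 <= B i k) /\ (forall k, \sum_i B i k <= 1).

Lemma column_substochastic1 : column_substochastic 1.
Proof.
split=> [i k|k]; first by rewrite mxE; case: eqP.
rewrite (bigD1 k)//= big1 ?addr0; first by rewrite mxE eqxx.
by move=> i ik; rewrite mxE (negPf ik).
Qed.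

Lemma column_sumM B C k :
  \sum_i (B *m C) i k = \sum_l (\sum_i B i l) * C l k.
Proof.
under eq_bigr do rewrite mxE.
by rewrite exchange_big; apply: eq_bigr => l _; rewrite mulr_suml.
Qed.

Lemma le_column_sumM B C k : column_substochastic B ->
  column_substochastic C -> \sum_i (B *m C) i k <= \sum_i C i k.
Proof.
move=> [_ B1] [C0 _]; rewrite column_sumM; apply: ler_sum => l _.
exact: ler_piMl.
Qed.

Lemma column_substochasticM B C : column_substochastic B ->
  column_substochastic C -> column_substochastic (B *m C).
Proof.
move=> sB sC; split=> [i k|k].
  by rewrite mxE sumr_ge0// => l _; rewrite mulr_ge0 ?sB.1 ?sC.1.
exact: le_trans (le_column_sumM k sB sC) (sC.2 k).
Qed.

Lemma column_substochasticX B t :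
  column_substochastic B -> column_substochastic (B ^+ t).
Proof.
move=> sB; elim: t => [|t IH]; first exact: column_substochastic1.
by rewrite exprS; exact: column_substochasticM.
Qed.

Lemma column_substochastic_le1 B i k : column_substochastic B -> B i k <= 1.
Proof.
move=> [B0 B1]; apply: le_trans (B1 k).
by rewrite (bigD1 i)//= ler_wpDr// sumr_ge0.
Qed.

Lemma norm_mulmx_column_substochastic B (w : 'cV[R]_n) i :
  column_substochastic B -> `|(B *m w) i 0| <= \sum_k `|w k 0|.
Proof.
move=> sB; rewrite mxE; apply: le_trans (ler_norm_sum _ _ _) _.
apply: ler_sum => k _; rewrite normrM (ger0_norm (sB.1 i k)).
by rewrite ler_piMl// column_substochastic_le1.
Qed.

(* If [B w - w = v] is fixed by [B] then [B ^+ t w = w + t v], which is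
   unbounded in [t] unless [v = 0]. *)
Lemma fixed_in_image_eq0 B (w : 'cV[R]_n) : column_substochastic B ->
  (B - 1%:M) *m ((B - 1%:M) *m w) = 0 -> (B - 1%:M) *m w = 0.
Proof.
move=> sB; set v := (B - 1%:M) *m w => Bv.
have {}Bv : B *m v = v.
  by apply/eqP; rewrite -subr_eq0 -{2}[v]mul1mx -mulmxBl Bv.
have Bw : B *m w = w + v by rewrite /v mulmxBl mul1mx addrCA subrr addr0.
clearbody v.
have BtE t : B ^+ t *m w = w + v *+ t.
  elim: t => [|t IH]; first by rewrite mul1mx mulr0n addr0.
  by rewrite exprS -mulmxA IH mulmxDr Bw -scaler_nat -scalemxAr Bv
     scaler_nat mulrS addrA.
apply/matrixP => i j; rewrite ord1 [RHS]mxE {j}; apply/eqP.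
apply: contraT => vi0; set M := \sum_k `|w k 0|.
have bnd t : `|v i 0| *+ t <= M + M.
  rewrite -normrMn; have -> : v i 0 *+ t = (B ^+ t *m w) i 0 - w i 0.
    by rewrite BtE mxE mulmxnE addrAC subrr add0r.
  apply: le_trans (ler_normB _ _) _; apply: lerD.
    exact/norm_mulmx_column_substochastic/column_substochasticX.
  by rewrite /M (bigD1 i)//= lerDl sumr_ge0.
have vp : 0 < `|v i 0| by rewrite normr_gt0.
have := bnd (Num.bound ((M + M) / `|v i 0|)).
rewrite leNgt -mulr_natr mulrC -ltr_pdivrMr//.
rewrite archi_boundP// divr_ge0// addr_ge0// /M sumr_ge0//.
Qed.

(** A row in the intersection is the transpose of some [(B - 1%:M) *m w] that [B] fixes, so
    [fixed_in_image_eq0] kills it. *)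
Lemma substochastic_kermx_disjoint B : column_substochastic B ->
  (kermx (B - 1%:M)^T :&: (B - 1%:M)^T = 0)%MS.
Proof.
move=> sB; apply/eqP/rowV0P => v; rewrite sub_capmx => /andP[/sub_kermxP vk].
move=> /submxP[w vE]; apply: trmx_inj; rewrite trmx0.
have vE' : v^T = (B - 1%:M) *m w^T by rewrite vE trmx_mul trmxK.
rewrite vE'; apply: fixed_in_image_eq0 => //.
by rewrite -vE' -[X in X *m _]trmxK -trmx_mul vk trmx0.
Qed.

End ColumnSubstochastic.

(** * The projection onto the kernel along the image *)

Section KerImProj.
Variables (F : fieldType) (n : nat) (A : 'M[F]_n).
Hypothesis dA : (kermx A^T :&: A^T = 0)%MS.

(** By rank-nullity the ranks of the two summands add up to [n], so a direct sum is everything. *)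
Lemma kermx_add_row_full : (1%:M <= kermx A^T + A^T)%MS.
Proof.
rewrite sub1mx /row_full mxrank_disjoint_sum// mxrank_ker.
by rewrite subnK ?rank_leq_row.
Qed.

Lemma mulmx_ker_im_proj : A *m ker_im_proj A = 0.
Proof.
apply: trmx_inj; rewrite trmx_mul trmxK trmx0; apply/sub_kermxP.
by rewrite -[X in (X <= _)%MS]mul1mx proj_mx_sub.
Qed.

Lemma ker_im_proj_compl (x : 'cV[F]_n) :
  exists w : 'cV[F]_n, x = ker_im_proj A *m x + A *m w.
Proof.
have /submxP[D DE] : (x^T *m proj_mx A^T (kermx A^T) <= A^T)%MS.
  exact: proj_mx_sub.
exists D^T; apply: trmx_inj; rewrite linearD/= !trmx_mul !trmxK -DE.
by rewrite add_proj_mx// (submx_trans (submx1 _))// kermx_add_row_full.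
Qed.

(** A matrix is determined by its action on two subspaces that together span the space: the identity
    is the sum of the two projections, and multiplying it by [W] leaves only one. *)
Lemma proj_mx_unique (W : 'M[F]_n) :
  kermx A^T *m W = kermx A^T -> A^T *m W = 0 -> W = proj_mx (kermx A^T) A^T.
Proof.
move=> kW aW; have := add_proj_mx dA kermx_add_row_full.
rewrite !mul1mx => /(congr1 (mulmxr W)); rewrite /= mulmxDl mul1mx => <-.
have /submxP[D ->] : (proj_mx (kermx A^T) A^T <= kermx A^T)%MS.
  by rewrite -[X in (X <= _)%MS]mul1mx proj_mx_sub.
have /submxP[E ->] : (proj_mx A^T (kermx A^T) <= A^T)%MS.
  by rewrite -[X in (X <= _)%MS]mul1mx proj_mx_sub.
by rewrite -[X in X + _]mulmxA -[X in _ + X]mulmxA kW aW mulmx0 addr0.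
Qed.

End KerImProj.

(** The limits are computed over the reals while the theorem projects over [R[i]]; this lemma links
    the two. The mapped projection acts as required on kernel and image, so uniqueness applies. *)
Lemma map_ker_im_proj (F K : fieldType) (f : {rmorphism F -> K}) (n : nat)
    (A : 'M[F]_n) : (kermx A^T :&: A^T = 0)%MS ->
  ker_im_proj (map_mx f A) = map_mx f (ker_im_proj A).
Proof.
move=> dA; rewrite /ker_im_proj map_trmx -map_kermx -[RHS]map_trmx; congr trmx.
have dK : (kermx (map_mx f A)^T :&: (map_mx f A)^T = 0)%MS.
  apply/eqP; rewrite map_trmx -map_kermx -mxrank_eq0 -map_capmx dA.
  by rewrite map_mx0 mxrank0.
symmetry; rewrite map_kermx -map_trmx; apply: proj_mx_unique => //.
  by rewrite map_trmx -map_kermx -map_mxM proj_mx_id.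
by rewrite map_trmx -map_mxM proj_mx_0// map_mx0.
Qed.

(** * The mean ergodic theorem for substochastic matrices *)

Section MeanErgodic.
Variables (R : realType) (n : nat) (B : 'M[R]_n).
Hypothesis sB : column_substochastic B.

(** Write [x = p + (B - 1%:M) *m w] with [p] fixed by [B]. The powers leave [p] unchanged, and the
    other part telescopes to [B ^+ N *m w - w], which is bounded in [N]. *)
Lemma cvg_mean_ergodic (x : 'cV[R]_n) i :
  (fun N : nat => N%:R^-1 * \sum_(t < N) (B ^+ t *m x) i 0) @ \oo
    --> (ker_im_proj (B - 1%:M) *m x) i 0.
Proof.
have dB := substochastic_kermx_disjoint sB.
have [w xE] := ker_im_proj_compl dB x.
set p := ker_im_proj (B - 1%:M) *m x in xE *.
have Bp : B *m p = p.
  apply/eqP; rewrite -subr_eq0 -{2}[p]mul1mx -mulmxBl.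
  by rewrite mulmxA mulmx_ker_im_proj mul0mx.
clearbody p.
have Btp t : B ^+ t *m p = p.
  by elim: t => [|t IH]; rewrite ?mul1mx// exprS -mulmxA IH.
have SE N : \sum_(t < N) (B ^+ t *m x) i 0 =
    p i 0 *+ N + ((B ^+ N *m w) i 0 - w i 0).
  elim: N => [|N IH]; first by rewrite big_ord0 mul1mx subrr addr0.
  rewrite big_ord_recr/= IH mulrSr -!addrA; congr (_ + _).
  rewrite [in (B ^+ N *m x) i 0]xE mulmxDr Btp mulmxBl mul1mx mulmxBr.
  rewrite mulmxA -[B ^+ N *m B]exprSr.
  by rewrite !mxE; ring.
apply/subr_cvg0; apply: norm_cvg0; set M := \sum_k `|w k 0|.
have M0 : (fun N : nat => N%:R^-1 * (M + M)) @ \oo --> (0 : R).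
  by rewrite -(mul0r (M + M)); apply: cvgMr_tmp; exact: cvg_invn.
apply: (squeeze_cvgr _ (cvg_cst 0) M0).
(* Cancelling [N] against its inverse requires [N] nonzero, which holds eventually. *)
near=> N; rewrite normr_ge0/= SE mulrDr -[p i 0 *+ N]mulr_natl mulKf; last first.
  by rewrite pnatr_eq0 -lt0n; near: N; exact: nbhs_infty_gt.
rewrite addrAC subrr add0r normrM ger0_norm ?invr_ge0//.
rewrite ler_wpM2l ?invr_ge0//; apply: le_trans (ler_normB _ _) _.
apply: lerD; first exact/norm_mulmx_column_substochastic/column_substochasticX.
by rewrite /M (bigD1 i)//= lerDl sumr_ge0.
Unshelve. all: by end_near. Qed.

(** Column sums of powers decrease and are nonnegative, so they converge. Their limit is also that
    of their Cesaro means, given by the mean ergodic theorem at the [k]-th basis vector. *)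
Lemma cvg_column_sumX k :
  (fun s => \sum_i (B ^+ s) i k) @ \oo
    --> \sum_i ker_im_proj (B - 1%:M) i k.
Proof.
set u := fun s => _.
have cu : cvgn u.
  apply: nonincreasing_is_cvgn.
    apply/nonincreasing_seqP => s; rewrite /u exprS.
    exact: le_column_sumM (column_substochasticX s sB).
  exists 0 => _ [s _ <-]; apply: sumr_ge0 => i _.
  by have [] := column_substochasticX s sB.
suff -> : \sum_i ker_im_proj (B - 1%:M) i k = limn u by [].
have colE (C : 'M[R]_n) i : C i k = (C *m (delta_mx k 0 : 'cV[R]_n)) i 0.
  by rewrite -colE mxE.
have := cvg_cesaro cu; set m := (fun N : nat => _).
suff cm : m @ \oo --> \sum_i ker_im_proj (B - 1%:M) i k.
  by move=> /(cvg_lim (@norm_hausdorff _ _)) <-;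
    rewrite (cvg_lim (@norm_hausdorff _ _) cm).
under eq_bigr do rewrite colE.
rewrite (_ : m = fun N : nat => \sum_i (N%:R^-1 *
    \sum_(t < N) (B ^+ t *m (delta_mx k 0 : 'cV[R]_n)) i 0)).
  by apply: cvg_sum_ord => i; exact: cvg_mean_ergodic.
apply/funext => N; rewrite -mulr_sumr; congr (_ * _).
by rewrite exchange_big; apply: eq_bigr => t _; apply: eq_bigr => i _;
  rewrite -colE.
Qed.

End MeanErgodic.

(** * Sums over paths as matrix products *)

Section Paths.
Variables (R : comPzRingType) (J : nat).
Implicit Types (B D : 'M[R]_J) (x : 'cV[R]_J).

Definition ffun_cons (T : Type) (n : nat) (a : T) (j : {ffun 'I_n.+1 -> T}) :
    {ffun 'I_n.+2 -> T} :=
  [ffun i => if unlift ord0 i is Some k then j k else a].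

Lemma ffun_cons0 (T : Type) n (a : T) (j : {ffun 'I_n.+1 -> T}) :
  ffun_cons a j ord0 = a.
Proof. by rewrite ffunE unlift_none. Qed.

Lemma ffun_cons_lift (T : Type) n (a : T) (j : {ffun 'I_n.+1 -> T}) k :
  ffun_cons a j (lift ord0 k) = j k.
Proof. by rewrite ffunE liftK. Qed.

Lemma big_ffun_cons (T : finType) n (F : {ffun 'I_n.+2 -> T} -> R) :
  \sum_j F j = \sum_(j : {ffun 'I_n.+1 -> T}) \sum_a F (ffun_cons a j).
Proof.
rewrite pair_big (reindex (fun p => ffun_cons p.2 p.1))//=.
exists (fun f : {ffun 'I_n.+2 -> T} => ([ffun k => f (lift ord0 k)], f ord0)).
  move=> [j a] _ /=; rewrite ffun_cons0; congr pair.
  by apply/ffunP => k; rewrite ffunE ffun_cons_lift.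
move=> f _; apply/ffunP => i; rewrite ffunE /=.
by case: unliftP => [k ->|->]; rewrite ?ffunE.
Qed.

(** The matrix may vary with time so that a single factor can be altered, as in [chain_insert]. *)
Definition path_weight (C : nat -> 'M[R]_J) x n
    (j : {ffun 'I_n.+1 -> 'I_J}) : R :=
  (\prod_(t < n) C t (j (lift ord0 t)) (j (widen_ord (leqnSn n) t)))
  * x (j ord0) 0.

(** This is the product of [C n.-1], ..., [C 0], [x] in that order, built from the right. *)
Fixpoint chain (C : nat -> 'M[R]_J) n x : 'cV[R]_J :=
  if n is n'.+1 then chain (C \o succn) n' (C 0%N *m x) else x.

(** Summing out the initial state replaces [x] by [C 0 *m x] and shortens the path by one step. *)
Lemma sum_path_weight C x n :
  \sum_j @path_weight C x n j = \sum_i chain C n x i 0.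
Proof.
elim: n C x => [|n IH] C x.
  rewrite (reindex (fun i : 'I_J => [ffun=> i] : {ffun 'I_1 -> 'I_J})).
    by apply: eq_bigr => i _; rewrite /path_weight big_ord0 mul1r ffunE.
  exists (fun f : {ffun 'I_1 -> 'I_J} => f ord0) => [i _|f _].
    by rewrite ffunE.
  by apply/ffunP => i; rewrite ffunE (ord1 i).
rewrite /= -IH big_ffun_cons; apply: eq_bigr => j _.
rewrite {2}/path_weight mxE mulr_sumr; apply: eq_bigr => a _.
rewrite /path_weight big_ord_recl ffun_cons0 ffun_cons_lift.
have -> : widen_ord (leqnSn n.+1) ord0 = ord0 by apply/val_inj.
rewrite ffun_cons0 -mulrA mulrCA; congr (_ * _).
apply: eq_bigr => t _ /=; rewrite ffun_cons_lift.
have -> : widen_ord (leqnSn n.+1) (lift ord0 t) =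
    lift ord0 (widen_ord (leqnSn n) t) by apply/val_inj.
by rewrite ffun_cons_lift.
Qed.

Lemma chain_const B n x : chain (fun=> B) n x = B ^+ n *m x.
Proof.
elim: n x => [|n IH] x /=; first by rewrite mul1mx.
by rewrite [LHS]IH exprSr mulmxA.
Qed.

Lemma chain_insert B D n x t : (t < n)%N ->
  chain (fun s => if s == t then D else B) n x =
  B ^+ (n - t.+1) *m (D *m (B ^+ t *m x)).
Proof.
elim: n t x => [//|n IH] [|t] x /=; last first.
  by rewrite ltnS => /IH {}IH; rewrite [LHS]IH subSS exprSr !mulmxA.
by move=> _; rewrite [LHS]chain_const subn1 mul1mx.
Qed.

Lemma sum_mulmx_col B x : \sum_i (B *m x) i 0 = \sum_k (\sum_i B i k) * x k 0.
Proof.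
under eq_bigr do rewrite mxE.
by rewrite exchange_big; apply: eq_bigr => k _; rewrite mulr_suml.
Qed.

(** The function [g] of step [t] is absorbed entrywise into the matrix used at time [t]. The entropy
    takes [g] to be the logarithm of the entries of [B]. *)
Lemma sum_path_weight_step B x n (g : 'I_J -> 'I_J -> R) (t : 'I_n) :
  \sum_j path_weight (fun=> B) x j
    * g (j (lift ord0 t)) (j (widen_ord (leqnSn n) t)) =
  \sum_a \sum_b
    (\sum_i (B ^+ (n - t.+1)) i a) * (B a b * g a b) * (B ^+ t *m x) b 0.
Proof.
pose D := \matrix_(a, b) (B a b * g a b).
transitivity (\sum_j @path_weight (fun s => if s == t then D else B) x n j).
  apply: eq_bigr => j _; rewrite /path_weight mulrAC; congr (_ * _).
  rewrite (bigD1 t)//= [RHS](bigD1 t)//= eqxx mxE mulrAC; congr (_ * _).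
  by apply: eq_bigr => s /negPf; rewrite -val_eqE /= => ->.
rewrite sum_path_weight chain_insert// sum_mulmx_col; apply: eq_bigr => a _.
by rewrite mxE mulr_sumr; apply: eq_bigr => b _; rewrite mxE mulrA.
Qed.

Lemma sum_path_weight_start B x n (g : 'I_J -> R) :
  \sum_(j : {ffun 'I_n.+1 -> 'I_J}) path_weight (fun=> B) x j * g (j ord0) =
  \sum_b (\sum_i (B ^+ n) i b) * (x b 0 * g b).
Proof.
(* Here [g] is absorbed into the initial vector. *)
pose y := \col_b (x b 0 * g b).
transitivity (\sum_j @path_weight (fun=> B) y n j).
  by apply: eq_bigr => j _; rewrite /path_weight mxE mulrA.
rewrite sum_path_weight chain_const sum_mulmx_col.
by apply: eq_bigr => b _; rewrite mxE.
Qed.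

End Paths.

(** * Inequalities and identities for [x ln x] *)

Section EntropyFunction.
Variable R : realType.

(** Each [f i] is at most the sum and [ln] increases on positive numbers; zero terms are treated
    apart. *)
Lemma ler_xlnx_sum (I : finType) (f : I -> R) : (forall i, 0 <= f i) ->
  \sum_i f i * ln (f i) <= (\sum_i f i) * ln (\sum_i f i).
Proof.
move=> f0; rewrite mulr_suml; apply: ler_sum => i _.
have [->|fi0] := eqVneq (f i) 0; first by rewrite !mul0r.
have fip : 0 < f i by rewrite lt_def fi0 f0.
have le : f i <= \sum_i f i by rewrite (bigD1 i)//= lerDl sumr_ge0.
by rewrite ler_wpM2l// ler_ln// posrE// (lt_le_trans fip).
Qed.

(** The factor [w] stays on every term so that the identity survives vanishing factors, where [ln]
    is not additive. *)
Lemma mulr_ln_prod (I : finType) (f : I -> R) (y : R) :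
  (forall i, 0 <= f i) -> 0 <= y ->
  let w := (\prod_i f i) * y in
  w * ln w = \sum_i w * ln (f i) + w * ln y.
Proof.
move=> f0 y0 w; have [->|w0] := eqVneq w 0.
  by rewrite !mul0r addr0 big1// => i _; rewrite mul0r.
rewrite -mulr_sumr -mulrDr; congr (_ * _).
have [y1 p1] : y != 0 /\ \prod_i f i != 0.
  by apply/andP; move: w0; rewrite mulf_eq0 negb_or andbC.
have fp i : 0 < f i by rewrite lt_def f0 andbT; move/prodf_neq0: p1; exact.
have ln_prod (r : seq I) : 0 < \prod_(i <- r) f i /\
    ln (\prod_(i <- r) f i) = \sum_(i <- r) ln (f i).
  elim: r => [|i r [rp rE]]; first by rewrite !big_nil ln1.
  by rewrite !big_cons mulr_gt0// lnM ?posrE// rE.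
by rewrite lnM ?posrE ?(ln_prod _).1 ?(ln_prod _).2// lt_def y1.
Qed.

End EntropyFunction.

(** * Entropy of the path weights and its growth rate *)

Section PathEntropy.
Variables (R : realType) (J : nat) (B : 'M[R]_J) (x : 'cV[R]_J).
Hypotheses (sB : column_substochastic B) (x0 : forall i, 0 <= x i 0).

Definition path_entropy (n : nat) : R :=
  - \sum_(j : {ffun 'I_n.+1 -> 'I_J})
      path_weight (fun=> B) x j * ln (path_weight (fun=> B) x j).

Lemma path_weight_ge0 n (j : {ffun 'I_n.+1 -> 'I_J}) :
  0 <= path_weight (fun=> B) x j.
Proof. by rewrite mulr_ge0// prodr_ge0// => t _; exact: sB.1. Qed.

(** The logarithm of a path weight splits into one term per step and one for the initial state; each
    is then summed over all paths. *)
Lemma path_entropyE n : path_entropy n =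
  - (\sum_a \sum_b B a b * ln (B a b) *
       \sum_(t < n) (\sum_i (B ^+ (n - t.+1)) i a) * (B ^+ t *m x) b 0)
  - \sum_b (\sum_i (B ^+ n) i b) * (x b 0 * ln (x b 0)).
Proof.
rewrite /path_entropy -opprD; congr (- _).
under eq_bigr => j _.
  rewrite {1 2}/path_weight mulr_ln_prod//; last by move=> t; exact: sB.1.
  rewrite -/(path_weight (fun=> B) x j).
  over.
rewrite big_split/= (sum_path_weight_start B x n (fun b => ln (x b 0))).
congr (_ + _); rewrite exchange_big/=.
under eq_bigr do rewrite (sum_path_weight_step B x (fun a b => ln (B a b))).
rewrite exchange_big/=; apply: eq_bigr => a _.
rewrite exchange_big/=; apply: eq_bigr => b _.
by rewrite mulr_sumr; apply: eq_bigr => t _; rewrite mulrAC mulrC.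
Qed.

Lemma cvg_path_entropy :
  (fun n : nat => n%:R^-1 * path_entropy n) @ \oo -->
  - \sum_a \sum_b (\sum_i ker_im_proj (B - 1%:M) i a) * B a b
      * (ker_im_proj (B - 1%:M) *m x) b 0 * ln (B a b).
Proof.
set P := ker_im_proj _; pose q (s : nat) k := \sum_i (B ^+ s) i k.
have -> : (fun n : nat => n%:R^-1 * path_entropy n) = fun n : nat =>
    - (\sum_a \sum_b B a b * ln (B a b) *
       (n%:R^-1 * \sum_(t < n) q (n - t.+1)%N a * (B ^+ t *m x) b 0))
    - n%:R^-1 * \sum_b q n b * (x b 0 * ln (x b 0)).
  apply/funext => n; rewrite path_entropyE mulrBr mulrN; congr (- _ - _).
  rewrite mulr_sumr; apply: eq_bigr => a _; rewrite mulr_sumr.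
  by apply: eq_bigr => b _; rewrite mulrCA.
rewrite -[X in _ --> X]subr0; apply: cvgB.
  apply: cvgN; apply: cvg_sum_ord => a; apply: cvg_sum_ord => b.
  rewrite (_ : _ * B a b * _ * _ =
    B a b * ln (B a b) * ((\sum_i P i a) * (P *m x) b 0)); last by ring.
  apply: cvgMl_tmp.
  have bM t : `|(B ^+ t *m x) b 0| <= \sum_k `|x k 0|.
    exact/norm_mulmx_column_substochastic/column_substochasticX.
  exact: cvg_cesaro_convolution (@cvg_column_sumX _ _ _ sB a) bM
    (@cvg_mean_ergodic _ _ _ sB x b).
(* The contribution of the initial state converges, so division by [n] sends it to 0. *)
have cS : (fun n => \sum_b q n b * (x b 0 * ln (x b 0))) @ \oo -->
    \sum_b (\sum_i P i b) * (x b 0 * ln (x b 0)).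
  apply: cvg_sum_ord => b; apply: cvgMr_tmp.
  exact: (@cvg_column_sumX _ _ _ sB b).
by have := cvgM (@cvg_invn R) cS; rewrite mul0r; exact.
Qed.

End PathEntropy.

Local Close Scope classical_set_scope.

(** * Comparing partition entropies with path entropy *)

Section OperatorEntropy.
Variables (R : realType) (J : nat) (mu : 'I_J -> R) (U : 'M[R[i]]_J).
Hypothesis mu_gt0 : forall j, 0 < mu j.

Lemma wdot_selfE (x : 'cV[R[i]]_J) :
  wdot mu x x = (\sum_j mu j * Normc.normc (x j 0) ^+ 2)%:C.
Proof.
rewrite rmorph_sum/=; apply: eq_bigr => j _.
by rewrite -mulrA -[_ * _^*]sqr_normc rmorphM rmorphXn.
Qed.

(** Testing the contraction on the [k]-th basis vector bounds the sum over [j] of [mu j * |U j k|^2]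
    by [mu k]. *)
Lemma weighted_contraction_column_substochastic :
  weighted_contraction mu U -> column_substochastic (bmatrix mu U).
Proof.
move=> hU; split=> [i k|k].
  by rewrite mxE mulr_ge0 ?sqr_ge0// divr_ge0// ltW.
have wge0 x : wdot mu x x \is Num.nneg.
  rewrite wdot_selfE nnegrE lecR sumr_ge0// => j _.
  by rewrite mulr_ge0 ?sqr_ge0// ltW.
have := hU (delta_mx k 0); rewrite /wnorm ler_sqrtC// !wdot_selfE lecR.
rewrite [leRHS](bigD1 k)//= [X in _ + X]big1 => [|j jk]; last first.
  by rewrite mxE (negPf jk) mulr0n Normc.normc0 expr0n mulr0.
rewrite mxE !eqxx Normc.normc1 expr1n addr0 -ler_pdivrMl// mulr_sumr.
apply: le_trans; apply: ler_sum => j _; rewrite -colE !mxE.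
by rewrite mulrAC [leRHS]mulrC.
Qed.

Lemma mu_col_ge0 i : 0 <= (\col_j mu j) i 0.
Proof. by rewrite mxE ltW. Qed.

Lemma cylinder_weightE (K : nat) (X : 'I_K.+1 -> {set 'I_J}) n
    (s : {ffun 'I_n.+1 -> 'I_K.+1}) :
  cylinder_weight mu U X s = \sum_(j : {ffun 'I_n.+1 -> 'I_J})
    (\prod_(t < n.+1) (j t \in X (s t)))%:R
    * path_weight (fun=> bmatrix mu U) (\col_j mu j) j.
Proof.
by apply: eq_bigr => j _; rewrite -mulrA natr_prod /path_weight mxE.
Qed.

Lemma partition_block (K : nat) (X : 'I_K.+1 -> {set 'I_J}) a :
  is_indexed_partition X -> (\sum_k (a \in X k) = 1)%N.
Proof.
move=> [dX cX]; have /finset.bigcupP[k _ ak] : a \in \bigcup_(i < K.+1) X i.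
  by rewrite cX inE.
rewrite (bigD1 k)//= ak big1// => i ik.
by rewrite (disjointFl (dX _ _ ik) ak).
Qed.

(** Every path lies in exactly one cylinder: by distributivity the sum is a product over times of
    block counts, each equal to 1. *)
Lemma sum_cylinder_indicator (K : nat) (X : 'I_K.+1 -> {set 'I_J}) n
    (j : {ffun 'I_n.+1 -> 'I_J}) : is_indexed_partition X ->
  (\sum_(s : {ffun 'I_n.+1 -> 'I_K.+1}) \prod_(t < n.+1) (j t \in X (s t))
    = 1)%N.
Proof.
move=> pX; rewrite -(bigA_distr_bigA (fun t k => (j t \in X k) : nat)).
by rewrite big1// => t _; exact: partition_block.
Qed.

Lemma partition_entropy_le (K : nat) (X : 'I_K.+1 -> {set 'I_J}) n :
  column_substochastic (bmatrix mu U) -> is_indexed_partition X ->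
  partition_entropy_n mu U X n <= path_entropy (bmatrix mu U) (\col_j mu j) n.
Proof.
move=> sB pX; rewrite /partition_entropy_n /path_entropy lerN2.
pose w := @path_weight R J (fun=> bmatrix mu U) (\col_j mu j) n.
pose c (s : {ffun 'I_n.+1 -> 'I_K.+1}) (j : {ffun 'I_n.+1 -> 'I_J}) :=
  (\prod_(t < n.+1) (j t \in X (s t)))%N.
apply: (@le_trans _ _ (\sum_s \sum_j
    ((c s j)%:R * w j) * ln ((c s j)%:R * w j))); last first.
  apply: ler_sum => s _; rewrite cylinder_weightE; apply: ler_xlnx_sum => j.
  by rewrite mulr_ge0// path_weight_ge0// => i; exact: mu_col_ge0.
rewrite exchange_big/=; apply: ler_sum => j _.
have -> : path_weight (fun=> bmatrix mu U) (\col_j mu j) j *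
    ln (path_weight (fun=> bmatrix mu U) (\col_j mu j) j) =
    (\sum_s c s j)%:R * (w j * ln (w j)).
  by rewrite sum_cylinder_indicator// mul1r.
rewrite natr_sum mulr_suml; apply: ler_sum => s _.
(* A factor 0 or 1 can be pulled out of [x ln x]. *)
have : c s j \in [:: 0%N; 1%N].
  rewrite /c; elim/big_ind: _ => //.
    by move=> m m'; rewrite !inE => /orP[]/eqP-> /orP[]/eqP->.
  by move=> t _; case: (j t \in X (s t)).
by rewrite !inE => /orP[]/eqP ->; rewrite ?mul0r ?mul1r.
Qed.

Lemma is_indexed_partition_set1 (K : nat) (JK : J = K.+1) :
  is_indexed_partition (fun i : 'I_K.+1 => [set cast_ord (esym JK) i]).
Proof.
split=> [i k ik|].
  by rewrite disjoints1 inE (inj_eq (@cast_ord_inj _ _ _)).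
apply/setP => a; rewrite inE; apply/finset.bigcupP; exists (cast_ord JK a) => //.
by rewrite inE cast_ordK.
Qed.

(** A cylinder over singletons contains a single path, so cylinder weights are path weights up to
    the relabelling by [JK]. *)
Lemma partition_entropy_set1 (K : nat) (JK : J = K.+1) n :
  partition_entropy_n mu U (fun i : 'I_K.+1 => [set cast_ord (esym JK) i]) n =
  path_entropy (bmatrix mu U) (\col_j mu j) n.
Proof.
congr (- _).
rewrite [RHS](reindex (fun s : {ffun 'I_n.+1 -> 'I_K.+1} =>
  [ffun t => cast_ord (esym JK) (s t)])); last first.
  exists (fun j : {ffun 'I_n.+1 -> 'I_J} => [ffun t => cast_ord JK (j t)]).
    by move=> s _; apply/ffunP => t; rewrite !ffunE cast_ordKV.
  by move=> j _; apply/ffunP => t; rewrite !ffunE cast_ordK.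
apply: eq_bigr => s _; set j0 := (X in path_weight _ _ X).
suff -> : cylinder_weight mu U (fun i => [set cast_ord (esym JK) i]) s =
  path_weight (fun=> bmatrix mu U) (\col_j mu j) j0 by [].
rewrite cylinder_weightE (bigD1 j0)//= [X in _ + X]big1 => [|j jj0]; last first.
  have [t tP] : exists t, j t != j0 t.
    by apply/existsP; rewrite -negb_forall; apply: contra jj0 => /forallP h;
      apply/eqP/ffunP => t; exact/eqP.
  by rewrite (bigD1 t)//= inE; move: tP; rewrite ffunE => /negPf ->;
    rewrite mul0n mul0r.
by rewrite big1 ?mul1r ?addr0// => t _; rewrite inE ffunE eqxx.
Qed.

(** The bound at each time passes to the limit, and the singletons attain it. *)
Lemma operator_entropyE (l : R) : (0 < J)%N ->
  column_substochastic (bmatrix mu U) ->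
  ((fun n : nat => n%:R^-1 * path_entropy (bmatrix mu U) (\col_j mu j) n)
    @ \oo --> l)%classic ->
  operator_entropy mu U = l%:E.
Proof.
move=> J0 sB cl; apply/eqP; rewrite eq_le; apply/andP; split.
  apply: ge_ereal_sup => _ [h [K [X [pX hX]] <-]]; rewrite lee_fin.
  apply: (ler_cvg_to hX cl); apply: nearW => n.
  by rewrite ler_wpM2l ?invr_ge0// partition_entropy_le.
have JK : J = J.-1.+1 by rewrite prednK.
apply: ereal_sup_ubound; exists l => //.
exists J.-1, (fun i => [set cast_ord (esym JK) i]); split.
  exact: is_indexed_partition_set1.
rewrite /is_partition_entropy.
by under eq_fun do rewrite partition_entropy_set1.
Qed.

End OperatorEntropy.

Theorem theorem6p1 (R : realType) (J : nat) (hJ : (0 < J)%N)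
    (mu : 'I_J -> R) (hmu : is_weight mu)
    (U : 'M[R[i]]_J) (hU : weighted_contraction mu U) :
  let B : 'M[R]_J := bmatrix mu U in
  let P : 'M[R[i]]_J := ker_im_proj (map_mx (real_complex R) B - 1%:M) in
  let e : 'cV[R[i]]_J := const_mx 1 in
  let m : 'cV[R[i]]_J := \col_j (mu j)%:C in
  operator_entropy mu U \is a fin_num
  /\ (fine (operator_entropy mu U))%:C
     = - \sum_(j < J) \sum_(k < J)
           (P^T *m e) j 0 * (B j k)%:C * (P *m m) k 0 * (ln (B j k))%:C.
Proof.
move=> B P e m.
have mu_gt0 j : 0 < mu j.
  by case: hmu => [[s [s0 _ ->]]|[->]].
have sB := weighted_contraction_column_substochastic mu_gt0 hU.
have := operator_entropyE mu_gt0 hJ sB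
  (cvg_path_entropy sB (mu_col_ge0 mu_gt0)).
rewrite -/B => ->; split => //=.
(* The complex projection is the real one embedded, so the formula reduces to the real limit. *)
have PE : P = map_mx (real_complex R) (ker_im_proj (B - 1%:M)).
  rewrite /P -(map_mx1 (real_complex R)) -map_mxB.
  exact: map_ker_im_proj (substochastic_kermx_disjoint sB).
have mE : m = map_mx (real_complex R) (\col_j mu j).
  by apply/matrixP => i k; rewrite !mxE.
rewrite PE mE -map_mxM rmorphN rmorph_sum; congr (- _).
apply: eq_bigr => j _; rewrite rmorph_sum; apply: eq_bigr => k _.
rewrite !rmorphM [in RHS]mxE; congr (_ * _ * _ * _).
  (* The entries of [P^T *m e] are the column sums of [P]. *)
  by rewrite rmorph_sum; apply: eq_bigr => i _; rewrite !mxE mulr1.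
by rewrite [RHS]mxE.
Qed.
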